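(* Given $0<p<q<\infty$, there is a $\varphi$-function $G$ such that $p_m(G)=p$, $q_m(G)=q$, $p(L_{1,G})=p/q$ and $q(L_{1,G})=q/p$.
   Context: A $\varphi$-function is a continuous, strictly increasing function $F:[0,\infty)\to[0,\infty)$ with $F(0)=0$ and $\lim_{t\to\infty}F(t)=\infty$. For a $\varphi$-function $F$ put $\tilde F(t)=1/F(1/t)$ for $t>0$ and $\tilde F(0)=0$. All functions live on $[0,\infty)$ with Lebesgue measure $\lambda$; $f^*(x)=\sup\{t:\lambda(|f|\ge t)\ge x\}$. Luxemburg functional: $\|f\|_G=\inf\{c>0:\int_0^\infty G(|f(x)|/c)\,dx\le1\}$. Orlicz--Lorentz functional: $\|f\|_{F,G}=\|f^*\circ\tilde F\circ\tilde G^{-1}\|_G$, space $L_{F,G}=\{f:\|f\|_{F,G}<\infty\}$; $L_{1,G}$ denotes $L_{T^1,G}$ where $T^1(t)=t$, so $\|f\|_{1,G}=\|f^*\circ\tilde G^{-1}\|_G$. Dilation operators $d_af(x)=f(ax)$ with $\|d_a\|_{X\to X}=\sup\{\|d_af\|_X/\|f\|_X:0<\|f\|_X<\infty\}$. Lower Boyd index $p(X)=\sup\{p:\exists c<\infty,\ \|d_a\|_{X\to X}\le c\,a^{-1/p}\ \forall a<1\}$; upper Boyd index $q(X)=\inf\{q:\exists c<\infty,\ \|d_a\|_{X\to X}\le c\,a^{-1/q}\ \forall a>1\}$. Matuszewska--Orlicz indices: $p_m(G)=\sup\{p:\exists c>0,\ G(at)\ge c\,a^pG(t)\ \forall t\ge0,\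 a>1\}$, $q_m(G)=\inf\{q:\exists c<\infty,\ G(at)\le c\,a^qG(t)\ \forall t\ge0,\ a>1\}$. *)

(* Defs.v *)
From HB Require Import structures.
From mathcomp Require Import all_boot all_order all_algebra.
From mathcomp Require Import all_classical all_reals all_analysis.
Set Implicit Arguments. Unset Strict Implicit. Unset Printing Implicit Defensive.
Import Order.TTheory GRing.Theory Num.Theory.
Import numFieldNormedType.Exports.
Local Open Scope classical_set_scope.
Local Open Scope ring_scope.

Section Defs.
Variable R : realType.

Definition halfline : set R := `[0, +oo[%classic.

Definition phi_function (F : R -> R) : Prop :=
  [/\ {within `[0, +oo[, continuous F},
      (forall x y : R, 0 <= x -> x < y -> F x < F y),
      F 0 = 0 &
      F x @[x --> +oo] --> +oo].

Definition tilde (F : R -> R) : R -> R :=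
  fun t => if t == 0 then 0 else (F t^-1)^-1.

(* inverse of a phi-function on [0,oo): F^{-1}(y) = sup {t >= 0 | F t <= y}
   (for a phi-function this is the genuine inverse function) *)
Definition phi_inv (F : R -> R) : R -> R :=
  fun y => sup [set t : R | 0 <= t /\ F t <= y].

Definition dec_rearr (f : R -> R) (x : R) : \bar R :=
  ereal_sup [set (t%:E)%E | t in [set t : R |
     (x%:E <= (@lebesgue_measure R) (setI halfline [set y | (t <= `|f y|)%R]))%E]].

(* extension of G to \bar R (the argument is always >= 0 in use) *)
Definition ext_phi (G : R -> R) (e : \bar R) : \bar R :=
  match e with
  | EFin r => (G r)%:E
  | +oo%E => +oo%E
  | -oo%E => 0%E
  end.

Definition luxemburg (G : R -> R) (g : R -> \bar R) : \bar R :=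
  ereal_inf [set (c%:E)%E | c in [set c : R | 0 < c /\
     (\int[(@lebesgue_measure R)]_(x in halfline)
        ext_phi G (`|g x| * (c^-1)%:E)%E <= 1)%E]].

Definition OL_norm (F G : R -> R) (f : R -> R) : \bar R :=
  luxemburg G (fun x => dec_rearr f (tilde F (phi_inv (tilde G) x))).

Definition L1G_norm (G : R -> R) : (R -> R) -> \bar R := OL_norm (fun t => t) G.

Definition dilation (a : R) (f : R -> R) : R -> R := fun x => f (a * x).

(* operator norm of d_a on the space X = {f measurable on [0,oo) | ||f||_X < oo}:
   sup { ||d_a f||_X / ||f||_X : 0 < ||f||_X < oo } *)
Definition dil_norm (N : (R -> R) -> \bar R) (a : R) : \bar R :=
  ereal_sup [set (N (dilation a f) * ((fine (N f))^-1)%:E)%E | f in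
     [set f : R -> R | measurable_fun halfline f /\
        (0 < N f)%E /\ (N f < +oo)%E]].

Definition boyd_lower (N : (R -> R) -> \bar R) : \bar R :=
  ereal_sup [set (p%:E)%E | p in [set p : R | 0 < p /\ exists c : R,
     forall a : R, 0 < a -> a < 1 -> (dil_norm N a <= (c * a `^ (- p^-1))%:E)%E]].

Definition boyd_upper (N : (R -> R) -> \bar R) : \bar R :=
  ereal_inf [set (q%:E)%E | q in [set q : R | 0 < q /\ exists c : R,
     forall a : R, 1 < a -> (dil_norm N a <= (c * a `^ (- q^-1))%:E)%E]].

Definition MO_lower (G : R -> R) : \bar R :=
  ereal_sup [set (p%:E)%E | p in [set p : R | exists2 c : R, 0 < c &
     forall t a : R, 0 <= t -> 1 < a -> c * a `^ p * G t <= G (a * t)]].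

Definition MO_upper (G : R -> R) : \bar R :=
  ereal_inf [set (q%:E)%E | q in [set q : R | exists c : R,
     forall t a : R, 0 <= t -> 1 < a -> G (a * t) <= c * a `^ q * G t]].

End Defs.

(* Main.v *)
Require Import Defs.
From HB Require Import structures.
From mathcomp Require Import all_boot all_order all_algebra.
From mathcomp Require Import all_classical all_reals all_analysis.
From mathcomp Require Import measurable_realfun ring lra.
Set Implicit Arguments.
Unset Strict Implicit.
Unset Printing Implicit Defensive.
Import Order.TTheory GRing.Theory Num.Theory.
Import numFieldNormedType.Exports.
Local Open Scope ring_scope.
Local Open Scope classical_set_scope.

(**
Call [u] a break of [G] from exponent [r] to exponent [s] if [G t] is
proportional to [t^r] on a long window below [u] and to [t^s] on a long window
above [u]. In the coordinate [v = ln t], let [ln G] be piecewise linear with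
slopes [q] and [p] alternating on blocks of growing length: then
[a^p G(t) <= G(a t) <= a^q G(t)] for [a >= 1], and there are arbitrarily large
breaks from [p] to [q] and from [q] to [p].

The growth bounds pass to [tilde G], and a linear change of variables in the
modular gives [||d_a|| <= a^(-q/p)] for [a <= 1] and [||d_a|| <= a^(-p/q)] for
[a >= 1].

Indicator functions satisfy [||1_A||_{1,G} = |A|], so they do not witness
sharpness. Instead take the step function [f = max_(k < N) y_k 1_[0, 1/x_k]]
with the [y_k] far apart: up to a factor 2, the modular of [d_a f] at [c] is
[\sum_k G(y_k / c) / G(a x_k)]. For [a = 1/b < 1], let [y_k] be breaks from [p]
to [q], [x_k = b y_k] and [N ~ b^q]: passing from [f] to [d_a f] multiplies each
term by [b^q], and only [c ~ b^(q/p)] compensates for this. For [a > 1], let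
[x_k] be breaks from [q] to [p], [y_k = x_k / D] and [N ~ D^q] with
[D ~ a^(p/q)].
*)

Section Lebesgue.
Context {R : realType}.
Local Notation mu := (@lebesgue_measure R).

Lemma lebesgue_measure_preimage_mulr (a : R) (A : set R) : 0 < a ->
  measurable A -> mu ( *%R a @^-1` A) = ((a^-1)%:E * mu A)%E.
Proof.
move=> a0 mA.
have ma : measurable_fun setT ( *%R a : measurableTypeR R -> measurableTypeR R).
  exact: mulrl_measurable.
pose m : {measure set (measurableTypeR R) -> \bar R} := mscale (NngNum (ltW a0))
  (pushforward mu ( *%R a : measurableTypeR R -> measurableTypeR R)).
have -> : mu A = (a%:E * mu ( *%R a @^-1` A))%E.
  rewrite (@lebesgue_measure_unique R (m ma))// => _ [[x y] _ <-].
  rewrite /m /= /mscale /= /pushforward.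
  rewrite [X in (_ * _ X)%E](_ : _ = `]x / a, y / a]%classic); last first.
    apply/seteqP; split => z /=; rewrite !in_itv /= ler_pdivlMr// ltr_pdivrMr//;
      by rewrite mulrC.
  rewrite !lebesgue_measure_itv /= !lte_fin ltr_pM2r ?invr_gt0//.
  case: ifP => _; last by rewrite mule0.
  by rewrite -!EFinB -EFinM -mulrBl mulrC divfK// gt_eqF.
by rewrite muleA -EFinM mulVf ?gt_eqF// mul1e.
Qed.

Lemma ge0_integral_mulr (a : R) (f : R -> \bar R) : 0 < a ->
  measurable_fun (`]0, +oo[ : set R) f -> (forall x, 0 < x -> (0 <= f x)%E) ->
  (\int[mu]_(x in `]0%R, +oo[) f (a * x)%R =
   (a^-1)%:E * \int[mu]_(x in `]0%R, +oo[) f x)%E.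
Proof.
move=> a0 mf f0.
have ma : measurable_fun setT ( *%R a : measurableTypeR R -> measurableTypeR R).
  exact: mulrl_measurable.
have ai0 : 0 <= a^-1 by rewrite invr_ge0 ltW.
have preE : `]0, +oo[ = *%R a @^-1` `]0, +oo[%classic :> set R.
  by apply/seteqP; split => z /=; rewrite !in_itv /= !andbT pmulr_rgt0.
have f0' x : `]0, +oo[%classic x -> (0 <= f x)%E.
  by rewrite /= in_itv /= andbT; exact: f0.
transitivity (\int[pushforward mu
  ( *%R a : measurableTypeR R -> measurableTypeR R)]_(x in `]0%R, +oo[) f x)%E.
  rewrite ge0_integral_pushforward//; first by rewrite -preE.
  by move=> x; rewrite inE; exact: f0'.
rewrite (@eq_measure_integral _ _ _ _ (mscale (NngNum ai0) mu)) => [|A mA _].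
  by rewrite ge0_integral_mscale.
exact: lebesgue_measure_preimage_mulr.
Qed.

Lemma nonincreasing_emeasurable (D : set R) (f : R -> \bar R) : is_interval D ->
  (forall x y, D x -> D y -> x <= y -> (f y <= f x)%E) -> measurable_fun D f.
Proof.
move=> itvD fni mD.
apply: (measurability _ (ErealGenCInfty.measurableE R)) => //.
move=> _ [_ [r ->] <-]; apply: is_interval_measurable.
move=> s t [Ds fs] [Dt ft] u sut; have Du := itvD _ _ Ds Dt _ sut.
have /andP[_ ut] := sut; move: ft; rewrite /= !in_itv /= !andbT => ft.
by split => //; rewrite (le_trans ft)// fni.
Qed.

End Lebesgue.

Section PowerFunctions.
Context {R : realType}.
Implicit Types (a c r s x : R).

Lemma powR_gt1 a r : 1 < a -> 0 < r -> 1 < a `^ r.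
Proof.
move=> a1 r0; have := @gt0_ltr_powR R r r0 1 a.
by rewrite powR1 !nnegrE; apply => //; exact: ltW (lt_trans ltr01 a1).
Qed.

Lemma powRVK x r : 0 <= x -> r != 0 -> (x `^ r^-1) `^ r = x.
Proof. by move=> x0 r0; rewrite -powRrM mulVf// powRr1. Qed.

Lemma powR_invl a r : 0 <= a -> a^-1 `^ r = (a `^ r)^-1.
Proof. by move=> a0; rewrite -powR_inv1// -powRrM mulN1r powRN. Qed.

Lemma cvgy_powR r : 0 < r -> a `^ r @[a --> +oo] --> +oo.
Proof.
move=> r0; apply/cvgryPge => A; near=> a.
have a0 : 0 <= a by [].
have A0 : 0 <= Num.max A 0 by rewrite le_max lexx orbT.
apply: (@le_trans _ _ (Num.max A 0)); first by rewrite le_max lexx.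
rewrite -[leLHS](powRVK A0 (lt0r_neq0 r0)).
by rewrite ge0_ler_powR ?nnegrE ?powR_ge0 ?(ltW r0).
Unshelve. all: by end_near. Qed.

Lemma near_powR_le_exponent c C r s : 0 < c ->
  (\forall a \near +oo, c * a `^ r <= C * a `^ s) -> r <= s.
Proof.
move=> c0 cC; rewrite leNgt -subr_gt0; apply/negP => /cvgy_powR/cvgryPgt oo.
near (+oo : set_system R) => a.
have a0 : 0 < a by [].
have : C / c < a `^ (r - s) by near: a; exact: oo.
rewrite ltr_pdivrMr// powRB ?(gt_eqF a0) ?implybT//.
rewrite mulrAC ltr_pdivlMr ?powR_gt0//.
by apply/negP; rewrite -leNgt [_ * c]mulrC; near: a.
Unshelve. all: by end_near. Qed.

End PowerFunctions.

Lemma tilde_id {R : realType} : tilde id = id :> (R -> R).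
Proof. by apply/funext => t; rewrite /tilde invrK; case: eqP. Qed.

Section PhiFunctions.
Context {R : realType}.
Variable F : R -> R.
Hypothesis phiF : phi_function F.
Implicit Types a b s t y : R.

Lemma phi_function_increasing s t : 0 <= s -> s < t -> F s < F t.
Proof. by case: phiF => _ + _ _; apply. Qed.

Lemma phi_function_le s t : 0 <= s -> 0 <= t -> (F s <= F t) = (s <= t).
Proof.
move=> s0 t0; case: (ltgtP s t) => [st|ts|->]; last by rewrite lexx.
- by rewrite ltW// phi_function_increasing.
- by rewrite leNgt phi_function_increasing.
Qed.

Lemma phi_function_gt0 t : 0 < t -> 0 < F t.
Proof.
by move=> t0; case: phiF => _ _ {1}<- _; exact: phi_function_increasing.
Qed.

Lemma phi_function_ge0 t : 0 <= t -> 0 <= F t.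
Proof. by move=> t0; case: phiF => _ _ <- _; rewrite phi_function_le. Qed.

Lemma phi_function_surj y : 0 <= y -> exists2 t, 0 <= t & F t = y.
Proof.
move=> y0; have [cF _ F0 /cvgryPge/(_ y) yF] := phiF.
near (+oo : set_system R) => b.
have b0 : 0 <= b by [].
have cFb : {within `[0, b], continuous F}.
  by apply: continuous_subspaceW cF; apply: subset_itvl.
have [|t t0b Fty] := IVT b0 cFb (v := y).
  by rewrite F0 min_l ?max_r ?phi_function_ge0// y0; near: b.
by exists t => //; move: t0b; rewrite in_itv => /andP[].
Unshelve. all: by end_near. Qed.

Lemma phi_function_surj_gt0 y : 0 < y -> exists2 t, 0 < t & F t = y.
Proof.
move=> y0; have [t t0 Fty] := phi_function_surj (ltW y0); exists t => //.
rewrite lt_neqAle t0 andbT; apply: contra_ltN y0 => /eqP t_eq0.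
by rewrite -Fty -t_eq0; case: phiF => _ _ -> _.
Qed.

Lemma phi_functionK t : 0 <= t -> phi_inv F (F t) = t.
Proof.
move=> t0; rewrite /phi_inv (_ : [set _ | _] = `[0, t]) ?sup_itvcc//.
apply/seteqP; split => s /=; rewrite in_itv/=.
- by case=> s0; rewrite phi_function_le// s0.
- by case/andP=> s0; rewrite phi_function_le.
Qed.

Lemma phi_inv_ge0 y : 0 <= y -> 0 <= phi_inv F y.
Proof. by move=> /phi_function_surj[t t0 <-]; rewrite phi_functionK. Qed.

Lemma phi_inv_gt0 y : 0 < y -> 0 < phi_inv F y.
Proof.
by move=> /phi_function_surj_gt0[t t0 <-]; rewrite phi_functionK ?(ltW t0).
Qed.

Lemma phi_inv_le y s : 0 <= y -> 0 <= s -> (phi_inv F y <= s) = (y <= F s).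
Proof.
move=> /phi_function_surj[t t0 <-] s0.
by rewrite phi_functionK// phi_function_le.
Qed.

Lemma phi_inv_nondecreasing x y :
  0 <= x -> x <= y -> phi_inv F x <= phi_inv F y.
Proof.
move=> x0 xy; have y0 := le_trans x0 xy.
by rewrite phi_inv_le ?phi_inv_ge0// (le_trans xy)// -phi_inv_le// phi_inv_ge0.
Qed.

Lemma phi_inv_scale_le a b y : 0 < a -> 0 < b ->
  (forall t, 0 <= t -> b * F t <= F (a * t)) -> 0 <= y ->
  phi_inv F (b * y) <= a * phi_inv F y.
Proof.
move=> a0 b0 bF y0; have Fy0 := phi_inv_ge0 y0.
rewrite phi_inv_le ?mulr_ge0 ?(ltW a0) ?(ltW b0)//; apply: le_trans (bF _ Fy0).
by rewrite ler_pM2l// -phi_inv_le.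
Qed.

(* At [t = 0] both sides vanish, since [0^-1 = 0]. *)
Lemma tildeE t : tilde F t = (F t^-1)^-1.
Proof.
rewrite /tilde; case: eqP => [->|//]; case: phiF => _ _ F0 _.
by rewrite invr0 F0 invr0.
Qed.

Lemma tilde_gt0 t : 0 < t -> 0 < tilde F t.
Proof. by move=> t0; rewrite tildeE invr_gt0 phi_function_gt0 ?invr_gt0. Qed.

Lemma phi_function_tilde : phi_function (tilde F).
Proof.
have [/continuous_within_itvcyP[cF F0r] _ F0 Fy] := phiF.
have -> : tilde F = fun t => (F t^-1)^-1 by apply/funext; exact: tildeE.
have Fi_gt0 t : 0 < t -> 0 < F t^-1.
  by move=> t0; rewrite phi_function_gt0 ?invr_gt0.
split; [|move=> s t|by rewrite invr0 F0 invr0|].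
- apply/continuous_within_itvcyP; split => [t|].
    rewrite in_itv/= andbT => t0; apply: cvgV; first by rewrite gt_eqF ?Fi_gt0.
    have cFi : F x @[x --> t^-1] --> F t^-1.
      by apply: cF; rewrite in_itv/= andbT invr_gt0.
    by apply: cvg_comp cFi; apply: cvgV; rewrite ?gt_eqF.
  rewrite invr0 F0 invr0; apply/gtr0_cvgV0; first by near=> t; exact: Fi_gt0.
  apply: cvg_comp Fy; apply/cvgrVy; first by near=> t.
  exact: cvg_at_right_filter.
- rewrite le_eqVlt => /predU1P[<-|s0] st.
    by rewrite invr0 F0 invr0 invr_gt0 Fi_gt0.
  have t0 := lt_trans s0 st.
  rewrite ltf_pV2 ?posrE ?Fi_gt0// phi_function_increasing ?ltf_pV2//.
  by rewrite invr_ge0 ltW.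
- apply/cvgryPge => A; have A1 : 0 < Num.max A 1 by rewrite lt_max ltr01 orbT.
  have [|s s0 Fs] := @phi_function_surj_gt0 (Num.max A 1)^-1.
    by rewrite invr_gt0.
  near=> t; have t0 : 0 < t by [].
  apply: (@le_trans _ _ (Num.max A 1)); first by rewrite le_max lexx.
  rewrite -[leLHS]invrK -Fs lef_pV2 ?posrE ?Fi_gt0 ?phi_function_gt0//.
  by rewrite phi_function_le ?invr_ge0 ?(ltW s0) ?(ltW t0)// invf_ple ?posrE.
Unshelve. all: by end_near. Qed.

End PhiFunctions.

Section Rearrangement.
Context {R : realType}.
Local Notation mu := (@lebesgue_measure R).
Implicit Types (f : R -> R) (x y t : R).

Lemma dec_rearr_ge0 f x : (0 <= dec_rearr f x)%E.
Proof.
apply: ereal_sup_ubound; exists 0 => //=.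
have -> : @halfline R `&` [set y | 0 <= `|f y|] = @halfline R.
  by apply/seteqP; split => z //= -[].
by rewrite lebesgue_measure_itv/= ltry leey.
Qed.

Lemma dec_rearr_nonincreasing f x y :
  x <= y -> (dec_rearr f y <= dec_rearr f x)%E.
Proof.
move=> xy; apply: ereal_sup_le => _ [t /= yt <-]; exists t => //=.
by apply: le_trans yt; rewrite lee_fin.
Qed.

Lemma measurable_superlevel f t : measurable_fun (@halfline R) f ->
  measurable (@halfline R `&` [set y | t <= `|f y|]).
Proof.
move=> mf; have mh : measurable (@halfline R) by exact: measurable_itv.
have /measurable_EFinP mnf := measurableT_comp (@normr_measurable R setT) mf.
exact: (emeasurable_fun_c_infty mh mnf t%:E).
Qed.

Lemma dec_rearr_dilation (a : R) f x : 0 < a ->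
  measurable_fun (@halfline R) f ->
  dec_rearr (dilation a f) x = dec_rearr f (a * x).
Proof.
move=> a0 mf; congr (ereal_sup (EFin @` _)); apply/funext => t /=.
have -> : @halfline R `&` [set y | t <= `|dilation a f y|] =
    *%R a @^-1` (@halfline R `&` [set y | t <= `|f y|]).
  apply/seteqP; split => y /=;
    by rewrite /halfline /= !in_itv /= !andbT pmulr_rge0.
rewrite lebesgue_measure_preimage_mulr ?lee_pdivlMl//.
exact: measurable_superlevel.
Qed.

Lemma dec_rearr_le f x M r : measurable_fun (@halfline R) f ->
  0 <= r -> r < x ->
  (forall y, r < y -> `|f y| <= M) -> (dec_rearr f x <= M%:E)%E.
Proof.
move=> mf r0 rx fM; apply/ereal_supP => _ [t /= xt <-]; rewrite lee_fin.
rewrite leNgt; apply/negP => Mt; move: xt; apply/negP; rewrite -ltNge.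
apply: (@le_lt_trans _ _ (mu `[0, r])); last first.
  rewrite lebesgue_measure_itv/= lte_fin.
  case: ifP => _; rewrite lte_fin ?subr0//.
  exact: le_lt_trans rx.
apply: le_measure; rewrite ?inE//; first exact: measurable_superlevel.
move=> y [] /=; rewrite /halfline /= !in_itv /= andbT => -> ty /=.
by rewrite leNgt; apply/negP => /fM; rewrite leNgt (lt_le_trans Mt).
Qed.

Lemma dec_rearr_ge f x t r : measurable_fun (@halfline R) f -> x <= r ->
  (forall y, 0 <= y <= r -> t <= `|f y|) -> (t%:E <= dec_rearr f x)%E.
Proof.
move=> mf xr ft; apply: ereal_sup_ubound; exists t => //=.
apply: (@le_trans _ _ (mu `[0, r])).
  rewrite lebesgue_measure_itv/= lte_fin.
  case: ltP => r0; rewrite lee_fin ?subr0//.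
  exact: le_trans r0.
apply: le_measure; rewrite ?inE//; first exact: measurable_superlevel.
move=> y /=; rewrite /halfline /= !in_itv /= andbT => yr; split; last exact: ft.
by case/andP: yr.
Qed.

End Rearrangement.

Definition L1G_integrand {R : realType} (G f : R -> R) (c x : R) : \bar R :=
  ext_phi G (dec_rearr f (phi_inv (tilde G) x) * (c^-1)%:E)%E.

Definition L1G_modular {R : realType} (G f : R -> R) (c : R) : \bar R :=
  (\int[@lebesgue_measure R]_(x in `]0%R, +oo[) L1G_integrand G f c x)%E.

Section L1GNorm.
Context {R : realType}.
Local Notation mu := (@lebesgue_measure R).
Variable G : R -> R.
Hypothesis phiG : phi_function G.
Local Notation H := (phi_inv (tilde G)).
Implicit Types (f : R -> R) (a b c x K : R) (e : \bar R).

Let phiT : phi_function (tilde G). Proof. exact: phi_function_tilde. Qed.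

Lemma ext_phi_ge0 e : (0 <= e -> 0 <= ext_phi G e)%E.
Proof. by case: e => [r| |]//=; rewrite !lee_fin; exact: phi_function_ge0. Qed.

Lemma ext_phi_le e1 e2 :
  (0 <= e1 -> e1 <= e2 -> ext_phi G e1 <= ext_phi G e2)%E.
Proof.
case: e1 e2 => [r| |]// [s| |]//=; rewrite ?leey// !lee_fin => r0 rs.
by rewrite phi_function_le// (le_trans r0).
Qed.

Lemma ext_phi_div_le K b e : 0 < K -> 0 < b ->
  (forall y, 0 <= y -> G (y / K) <= b * G y) -> (0 <= e)%E ->
  (ext_phi G (e * (K^-1)%:E) <= b%:E * ext_phi G e)%E.
Proof.
move=> K0 b0 Gb; case: e => [r| |]//= r0; first by rewrite lee_fin Gb.
by rewrite gt0_muley ?lte_fin// leey.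
Qed.

Lemma L1G_integrand_ge0 f c x : 0 < c -> (0 <= L1G_integrand G f c x)%E.
Proof.
move=> c0; apply/ext_phi_ge0/mule_ge0; first exact: dec_rearr_ge0.
by rewrite lee_fin invr_ge0 ltW.
Qed.

Lemma L1G_integrand_nonincreasing f c x y : 0 < c -> 0 < x -> x <= y ->
  (L1G_integrand G f c y <= L1G_integrand G f c x)%E.
Proof.
move=> c0 x0 xy; have ci0 : (0 <= (c^-1)%:E)%E by rewrite lee_fin invr_ge0 ltW.
apply: ext_phi_le; first by rewrite mule_ge0// dec_rearr_ge0.
rewrite lee_wpmul2r// dec_rearr_nonincreasing//.
exact: (phi_inv_nondecreasing phiT (ltW x0)).
Qed.

Lemma measurable_L1G_integrand f c : 0 < c ->
  measurable_fun (`]0, +oo[ : set R) (L1G_integrand G f c).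
Proof.
move=> c0; apply: nonincreasing_emeasurable; first exact: interval_is_interval.
move=> x y /=; rewrite !in_itv/= !andbT => x0 _.
exact: L1G_integrand_nonincreasing.
Qed.

Lemma L1G_modular_nonincreasing f c d : 0 < c -> c <= d ->
  (L1G_modular G f d <= L1G_modular G f c)%E.
Proof.
move=> c0 cd; have d0 := lt_le_trans c0 cd.
have ci0 : (0 <= (d^-1)%:E)%E by rewrite lee_fin invr_ge0 ltW.
apply: ge0_le_integral => //=.
- by move=> x _; exact: L1G_integrand_ge0.
- exact: measurable_L1G_integrand.
- exact: measurable_L1G_integrand.
- move=> x _; apply: ext_phi_le; first by rewrite mule_ge0 ?dec_rearr_ge0.
  by rewrite lee_wpmul2l ?dec_rearr_ge0// lee_fin lef_pV2.
Qed.

Lemma L1G_normE f : L1G_norm G f =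
  ereal_inf [set c%:E | c in [set c | 0 < c /\ (L1G_modular G f c <= 1)%E]].
Proof.
have modularE c : 0 < c -> (\int[mu]_(x in @halfline R) ext_phi G
    (`|dec_rearr f (tilde id (H x))| * (c^-1)%:E) = L1G_modular G f c)%E.
  move=> c0; rewrite /L1G_modular integral_itv_obnd_cbnd.
    by apply: eq_integral => x _; rewrite gee0_abs ?dec_rearr_ge0// tilde_id.
  exact: measurable_L1G_integrand.
by congr (ereal_inf (EFin @` _)); apply/seteqP; split => c -[c0];
  rewrite /= modularE.
Qed.

Lemma L1G_norm_le f c : 0 < c -> (L1G_modular G f c <= 1)%E ->
  (L1G_norm G f <= c%:E)%E.
Proof.
by move=> c0 mc; rewrite L1G_normE; apply: ereal_inf_lbound; exists c.
Qed.

Lemma L1G_norm_ge f c : 0 < c -> (1 < L1G_modular G f c)%E ->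
  (c%:E <= L1G_norm G f)%E.
Proof.
move=> c0 mc; rewrite L1G_normE; apply: le_ereal_inf_tmp => _ [d [d0 md] <-].
rewrite lee_fin leNgt; apply/negP => /ltW dc.
by move: mc; rewrite ltNge (le_trans (L1G_modular_nonincreasing f d0 dc)).
Qed.

Section Dilation.
Variables a b K : R.
Hypotheses (a_gt0 : 0 < a) (b_gt0 : 0 < b) (K_gt0 : 0 < K).
Hypothesis tilde_ge : forall t, 0 <= t -> b * tilde G t <= tilde G (a * t).
Hypothesis G_le : forall y, 0 <= y -> G (y / K) <= b * G y.

Lemma L1G_integrand_dilation_le f c x :
  measurable_fun (@halfline R) f -> 0 < c -> 0 < x ->
  (L1G_integrand G (dilation a f) (K * c) x <=
    b%:E * L1G_integrand G f c (b * x))%E.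
Proof.
move=> mf c0 x0; have Kc0 : 0 < K * c by rewrite mulr_gt0.
rewrite /L1G_integrand dec_rearr_dilation//.
have inv_ge0 r : 0 < r -> (0 <= (r^-1)%:E)%E.
  by rewrite lee_fin invr_ge0 => /ltW.
apply: (@le_trans _ _ (L1G_integrand G f (K * c) (b * x))).
  apply: ext_phi_le; first by rewrite mule_ge0 ?dec_rearr_ge0 ?inv_ge0.
  rewrite lee_wpmul2r ?inv_ge0// dec_rearr_nonincreasing//.
  by rewrite phi_inv_scale_le// ltW.
rewrite /L1G_integrand invfM [(K^-1 * _)%R]mulrC EFinM muleA ext_phi_div_le//.
by rewrite mule_ge0 ?dec_rearr_ge0 ?inv_ge0.
Qed.

Lemma L1G_modular_dilation_le f c : measurable_fun (@halfline R) f -> 0 < c ->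
  (L1G_modular G (dilation a f) (K * c) <= L1G_modular G f c)%E.
Proof.
move=> mf c0; have Kc0 : 0 < K * c by rewrite mulr_gt0.
have mb : measurable_fun (`]0, +oo[ : set R)
    (fun x => L1G_integrand G f c (b * x)).
  apply: nonincreasing_emeasurable; first exact: interval_is_interval.
  move=> x y /=; rewrite !in_itv/= !andbT => x0 _ xy.
  by apply: L1G_integrand_nonincreasing; rewrite ?mulr_gt0 ?ler_pM2l.
have -> : L1G_modular G f c =
    (\int[mu]_(x in `]0%R, +oo[) (b%:E * L1G_integrand G f c (b * x)%R))%E.
  rewrite ge0_integralZl//=; last 2 first.
  - by move=> x _; exact: L1G_integrand_ge0.
  - exact: ltW.
  rewrite (@ge0_integral_mulr R b (L1G_integrand G f c))//.
  - by rewrite muleA -EFinM mulfV ?gt_eqF// mul1e.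
  - exact: measurable_L1G_integrand.
  - by move=> x _; exact: L1G_integrand_ge0.
apply: ge0_le_integral => //=.
- by move=> x _; exact: L1G_integrand_ge0.
- exact: measurable_L1G_integrand.
- exact: measurable_funeM.
- by move=> x; rewrite in_itv/= andbT => x0; exact: L1G_integrand_dilation_le.
Qed.

Lemma L1G_norm_dilation_le f : measurable_fun (@halfline R) f ->
  (L1G_norm G (dilation a f) <= K%:E * L1G_norm G f)%E.
Proof.
move=> mf; rewrite -lee_pdivrMl// [leRHS]L1G_normE.
apply: le_ereal_inf_tmp => _ [c [c0 mc] <-]; rewrite lee_pdivrMl// -EFinM.
apply: L1G_norm_le; first exact: mulr_gt0.
exact: le_trans (L1G_modular_dilation_le mf c0) mc.
Qed.

End Dilation.

End L1GNorm.

Section StepFunctions.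
Context {R : realType}.
Local Notation mu := (@lebesgue_measure R).
Implicit Types (N : nat) (a r s x : R) (g w y : nat -> R).

Lemma sum_le_double_bigmax N (P : pred nat) g :
  (forall k, 0 <= g k) -> (forall k, 2 * g k <= g k.+1) ->
  \sum_(k < N | P k) g k <= 2 * \big[Num.max/0]_(k < N | P k) g k.
Proof.
move=> g0 g2; have sum_le n : \sum_(k < n) g k <= g n.
  elim: n => [|n IH]; first by rewrite big_ord0.
  by rewrite big_ord_recr/=; apply: le_trans (g2 n); lra.
elim: N => [|N IH]; first by rewrite !big_ord0 mulr0.
rewrite big_mkcond big_ord_recr -big_mkcond/=; case: ifP => PN.
- apply: (@le_trans _ _ (2 * g N)); last first.
    rewrite ler_pM2l//.
    exact: (le_bigmax_cond _ (fun k : 'I_N.+1 => g k) (j := ord_max)).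
  rewrite mulr2n mulrDl mul1r lerD2r (le_trans _ (sum_le N))// big_mkcond.
  by apply: ler_sum => k _; case: ifP.
- rewrite addr0 (le_trans IH)// ler_pM2l//.
  exact: (@le_bigmax_ord_cond _ _ _ _ _ P P g).
Qed.

Lemma sum_step_indicE N g w x : 0 < x ->
  \sum_(k < N | x <= w k) g k = \sum_(k < N) g k * \1_(`]0, w k]) x.
Proof.
move=> x0; rewrite big_mkcond; apply: eq_bigr => k _.
by rewrite indicE mem_setE in_itv/= x0/=; case: ifP; rewrite ?mulr1 ?mulr0.
Qed.

Lemma measurable_sum_step N g w :
  measurable_fun (`]0, +oo[ : set R)
    (fun x : R => (\sum_(k < N | x <= w k) g k)%:E).
Proof.
apply: (eq_measurable_fun (fun x => (\sum_(k < N) g k * \1_(`]0, w k]) x)%:E)).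
  by move=> x; rewrite inE/= in_itv/= andbT => x0; rewrite sum_step_indicE.
by apply/measurable_EFinP; apply: measurable_sum => k; exact: measurable_funM.
Qed.

Lemma integral_sum_step N g w : (forall k, 0 <= g k) -> (forall k, 0 < w k) ->
  (\int[mu]_(x in `]0%R, +oo[) (\sum_(k < N | x <= w k) g k)%:E =
   (\sum_(k < N) g k * w k)%:E)%E.
Proof.
move=> g0 w0; rewrite -sumEFin.
have m_indic k : measurable_fun (`]0, +oo[ : set R)
    (fun x => (\1_(`]0, w k]) x)%:E : \bar R).
  by apply/measurable_EFinP; exact: measurable_indic.
under [RHS]eq_bigr => k _.
  have -> : ((g k * w k)%:E =
      \int[mu]_(x in `]0%R, +oo[) ((g k)%:E * (\1_(`]0, w k]) x)%:E))%E.
    rewrite ge0_integralZl//=; last 2 first.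
    - exact: m_indic.
    - by rewrite lee_fin.
    rewrite integral_indic// setIidl/=; last first.
      by apply: subset_itvl; rewrite bnd_simp.
    by rewrite lebesgue_measure_itv/= lte_fin w0 sube0.
  over.
rewrite -ge0_integral_sum//=; last 2 first.
- by move=> k; apply: measurable_funeM; exact: m_indic.
- by move=> k x _; rewrite mule_ge0 ?lee_fin.
apply: eq_integral => x; rewrite inE/= in_itv/= andbT => x0.
by rewrite sum_step_indicE// -sumEFin.
Qed.

Definition step_max N w y x : R := \big[Num.max/0]_(k < N | x <= w k) y k.

Lemma step_max_ge0 N w y x : 0 <= step_max N w y x.
Proof. exact: bigmax_ge_id. Qed.

Lemma step_max_nonincreasing N w y x s :
  x <= s -> step_max N w y s <= step_max N w y x.
Proof. by move=> xs; apply: sub_bigmax => k; exact: le_trans. Qed.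

Lemma measurable_step_max N w y (D : set R) : measurable D ->
  measurable_fun D (step_max N w y).
Proof.
move=> mD; apply: nonincreasing_measurable => // x s.
exact: step_max_nonincreasing.
Qed.

Lemma dilation_step_max N w y a : 0 < a ->
  dilation a (step_max N w y) = step_max N (fun k => w k / a) y.
Proof.
move=> a0; apply/funext => x; rewrite /dilation /step_max.
by apply: eq_bigl => k; rewrite ler_pdivlMr// mulrC.
Qed.

Lemma dec_rearr_step_max N w y x : 0 < x ->
  dec_rearr (step_max N w y) x = (step_max N w y x)%:E.
Proof.
move=> x0; have mf : measurable_fun (@halfline R) (step_max N w y).
  by apply: measurable_step_max; exact: measurable_itv.
pose r := \big[Num.max/0]_(k < N | w k < x) w k.
apply/eqP; rewrite eq_le; apply/andP; split.
- apply: (@dec_rearr_le _ _ _ _ r) => //.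
  + exact: bigmax_ge_id.
  + by apply: bigmax_lt.
  + move=> s rs; rewrite ger0_norm ?step_max_ge0//; apply: sub_bigmax => k swk.
    rewrite leNgt; apply: contraTN rs => wkx; rewrite -leNgt (le_trans swk)//.
    exact: (le_bigmax_cond _ (fun k : 'I_N => w k)).
- apply: (@dec_rearr_ge _ _ _ _ x) => // s /andP[_ sx].
  by rewrite ger0_norm ?step_max_ge0// step_max_nonincreasing.
Qed.

End StepFunctions.

Section StepModular.
Context {R : realType}.
Variables (G : R -> R) (N : nat) (w y : nat -> R) (c : R).
Hypotheses (phiG : phi_function G) (c_gt0 : 0 < c).
Hypotheses (w_gt0 : forall k, 0 < w k) (y_gt0 : forall k, 0 < y k).
Local Notation W := (tilde G \o w).
Local Notation modular_sum := (\sum_(k < N) G (y k / c) * tilde G (w k)).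

Let W_gt0 k : 0 < W k. Proof. exact: tilde_gt0. Qed.
Let Gy_ge0 k : 0 <= G (y k / c).
Proof. by rewrite phi_function_ge0 ?divr_ge0 ?ltW. Qed.

Lemma L1G_integrand_step_max x : 0 < x ->
  L1G_integrand G (step_max N w y) c x = (G (step_max N W y x / c))%:E.
Proof.
move=> x0; have phiT := phi_function_tilde phiG.
rewrite /L1G_integrand dec_rearr_step_max ?phi_inv_gt0// -EFinM/=.
congr (G (_ / c))%:E; apply: eq_bigl => k.
by rewrite phi_inv_le// ltW.
Qed.

Lemma L1G_modular_step_max_le :
  (L1G_modular G (step_max N w y) c <= modular_sum%:E)%E.
Proof.
rewrite -(@integral_sum_step _ N (fun k => G (y k / c)) W)//.
apply: ge0_le_integral => //=.
- by move=> x _; exact: (L1G_integrand_ge0 phiG).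
- exact: (measurable_L1G_integrand phiG).
- exact: (measurable_sum_step N (fun k => G (y k / c)) W).
move=> x; rewrite in_itv/= andbT => x0.
rewrite L1G_integrand_step_max// lee_fin /step_max.
set m := \big[_/_]_(_ < _ | _) _; set S := \sum_(_ < _ | _) _.
suff [_] : 0 <= m /\ G (m / c) <= S by [].
apply: (big_ind2 (fun m S => 0 <= m /\ G (m / c) <= S)) => [|m1 S1 m2 S2|k _].
- by case: phiG => _ _ + _; rewrite mul0r => ->.
- move=> [m10 GS1] [m20 GS2]; rewrite le_max m10; split => //.
  have := le_trans (phi_function_ge0 phiG (divr_ge0 m10 (ltW c_gt0))) GS1.
  have := le_trans (phi_function_ge0 phiG (divr_ge0 m20 (ltW c_gt0))) GS2.
  by case: (leP m1 m2) => _; lra.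
- by split => //; exact: ltW.
Qed.

Lemma L1G_modular_step_max_ge : (forall k, 2 * G (y k / c) <= G (y k.+1 / c)) ->
  ((2^-1 * modular_sum)%:E <= L1G_modular G (step_max N w y) c)%E.
Proof.
move=> Gy2; have mS := @measurable_sum_step R N (fun k => G (y k / c)) W.
rewrite EFinM -(@integral_sum_step _ N (fun k => G (y k / c)) W)//.
rewrite -ge0_integralZl//; last by move=> x _; rewrite lee_fin sumr_ge0.
apply: ge0_le_integral => //=.
- by move=> x _; rewrite -EFinM lee_fin mulr_ge0// sumr_ge0.
- exact: measurable_funeM.
- exact: (measurable_L1G_integrand phiG).
move=> x; rewrite in_itv/= andbT => x0; rewrite L1G_integrand_step_max//.
rewrite -EFinM lee_fin ler_pdivrMl//.
apply: le_trans (sum_le_double_bigmax N (fun k => x <= W k) Gy_ge0 Gy2) _.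
rewrite ler_pM2l//; apply: bigmax_le => [|k xWk].
  by rewrite phi_function_ge0// divr_ge0 ?step_max_ge0// ltW.
rewrite phi_function_le ?divr_ge0 ?step_max_ge0 ?(ltW c_gt0) ?(ltW (y_gt0 k))//.
rewrite ler_pM2r ?invr_gt0//.
exact: (le_bigmax_cond _ (fun k : 'I_N => y k)).
Qed.

Lemma L1G_norm_step_max_le : modular_sum <= 1 ->
  (L1G_norm G (step_max N w y) <= c%:E)%E.
Proof.
move=> sum1; apply: (L1G_norm_le phiG c_gt0).
by apply: le_trans L1G_modular_step_max_le _; rewrite lee_fin.
Qed.

Lemma L1G_norm_step_max_ge : (forall k, 2 * G (y k / c) <= G (y k.+1 / c)) ->
  2 < modular_sum -> (c%:E <= L1G_norm G (step_max N w y))%E.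
Proof.
move=> Gy2 sum2; apply: (L1G_norm_ge phiG c_gt0).
apply: lt_le_trans (L1G_modular_step_max_ge Gy2).
by rewrite lte_fin ltr_pdivlMl ?mulr1.
Qed.

End StepModular.

Definition power_growth {R : realType} (p q : R) (G : R -> R) : Prop :=
  [/\ G 0 = 0, (forall t : R, 0 < t -> 0 < G t) &
      (forall t a : R, 0 < t -> 1 <= a ->
         a `^ p * G t <= G (a * t) <= a `^ q * G t)].

Section PowerGrowth.
Context {R : realType}.
Variables (p q : R) (G : R -> R).
Hypotheses (p_gt0 : 0 < p) (GP : power_growth p q G).
Implicit Types a s t x : R.

Let G0 : G 0 = 0. Proof. by case: GP. Qed.
Let G_gt0 t : 0 < t -> 0 < G t. Proof. by case: GP => _ + _; apply. Qed.

Lemma power_growth_exponent_le : p <= q.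
Proof.
apply: (@near_powR_le_exponent _ 1 1) => //; near=> a.
have a1 : 1 <= a by near: a; apply: nbhs_pinfty_ge; exact: num_real.
have [_ _ /(_ _ _ ltr01 a1)/andP[Gp Gq]] := GP.
by rewrite !mul1r -(ler_pM2r (G_gt0 ltr01)) (le_trans Gp).
Unshelve. all: by end_near. Qed.

Lemma power_growth_exponent_gt0 : 0 < q.
Proof. exact: lt_le_trans power_growth_exponent_le. Qed.

Lemma power_growth_ge1 t a : 0 <= t -> 1 <= a ->
  a `^ p * G t <= G (a * t) <= a `^ q * G t.
Proof.
rewrite le_eqVlt => /predU1P[<- _|t0 a1]; first by rewrite mulr0 G0 !mulr0 lexx.
by case: GP => _ _; apply.
Qed.

Lemma power_growth_le1 t a : 0 <= t -> 0 < a <= 1 ->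
  a `^ q * G t <= G (a * t) <= a `^ p * G t.
Proof.
move=> t0 /andP[a0 a1]; have at0 : 0 <= a * t by rewrite mulr_ge0// ltW.
have ai1 : 1 <= a^-1 by rewrite invf_ge1.
have := power_growth_ge1 at0 ai1.
rewrite mulKf ?gt_eqF// !powR_invl ?(ltW a0)//.
by rewrite ler_pdivrMl ?ler_pdivlMl ?powR_gt0// andbC.
Qed.

Lemma power_growth_increasing s t : 0 <= s -> s < t -> G s < G t.
Proof.
rewrite le_eqVlt => /predU1P[<- t0|s0 st]; first by rewrite G0 G_gt0.
have st1 : 1 < t / s by rewrite ltr_pdivlMr ?mul1r.
have /andP[+ _] := power_growth_ge1 (ltW s0) (ltW st1).
rewrite divfK ?gt_eqF//; apply: lt_le_trans.
by rewrite ltr_pMl ?G_gt0// powR_gt1.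
Qed.

Lemma power_growth_ln_lipschitz s t : 0 < s -> 0 < t ->
  G s <= expR (q * `|ln s - ln t|) * G t.
Proof.
move=> s0 t0; have [ts|st] := leP t s.
- have st1 : 1 <= s / t by rewrite ler_pdivlMr ?mul1r.
  have /andP[_] := power_growth_ge1 (ltW t0) st1.
  rewrite divfK ?gt_eqF// => /le_trans; apply.
  rewrite ler_pM2r ?G_gt0// /powR gt_eqF ?divr_gt0// ler_expR ln_div//.
  by rewrite ler_wpM2l ?ler_norm// ltW// power_growth_exponent_gt0.
- apply: le_trans (ltW (power_growth_increasing (ltW s0) st)) _.
  rewrite ler_peMl ?(ltW (G_gt0 _))// -expR0 ler_expR mulr_ge0//.
  by rewrite ltW// power_growth_exponent_gt0.
Qed.

Lemma power_growth_continuous t : 0 < t -> {for t, continuous G}.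
Proof.
move=> t0.
pose d s : R := q * `|ln s - ln t|.
have d0 : d s @[s --> t] --> (0 : R).
  have -> : 0 = q * `|ln t - ln t| by rewrite subrr normr0 mulr0.
  apply: cvgM; first exact: cvg_cst.
  apply: cvg_norm; apply: cvgB; [exact: continuous_ln|exact: cvg_cst].
have cvg_expR (e : R -> R) : e s @[s --> t] --> (0 : R) ->
    expR (e s) * G t @[s --> t] --> G t.
  rewrite -{2}[G t]mul1r -expR0 => e0; apply: cvgM; last exact: cvg_cst.
  by apply: continuous_cvg => //; exact: continuous_expR.
apply: (@squeeze_cvgr _ _ _ _ (fun s => expR (- d s) * G t)
  (fun s => expR (d s) * G t)).
- near=> s; have s0 : 0 < s by near: s; exact: lt_nbhsr.
  rewrite power_growth_ln_lipschitz// andbT expRN ler_pdivrMl ?expR_gt0//.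
  by rewrite /d distrC power_growth_ln_lipschitz.
- by apply: cvg_expR; rewrite -oppr0; exact: cvgN.
- exact: cvg_expR.
Unshelve. all: by end_near. Qed.

Lemma power_growth_phi_function : phi_function G.
Proof.
split; [|exact: power_growth_increasing|exact: G0|].
- apply/continuous_within_itvcyP; split => [t|].
    by rewrite in_itv/= andbT; exact: power_growth_continuous.
  rewrite G0; apply: (@squeeze_cvgr _ _ _ _ (cst 0) (fun t => t `^ p * G 1)).
  + near=> t; rewrite ltW ?G_gt0//=.
    have t01 : 0 < t <= 1.
      by apply/andP; split => //; near: t; exact: nbhs_right_le.
    by have /andP[_] := power_growth_le1 ler01 t01; rewrite mulr1.
  + exact: cvg_cst.
  + rewrite -{2}(mul0r (G 1)).
    by apply: cvgM; [exact: powR_cvg0|exact: cvg_cst].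
- apply: (@ger_cvgy _ _ _ _ (fun t => t `^ p * G 1)).
    near=> t; have t1 : 1 <= t.
      by near: t; apply: nbhs_pinfty_ge; exact: num_real.
    by have /andP[+ _] := power_growth_ge1 ler01 t1; rewrite mulr1.
  by apply: gt0_cvgMly; [exact: G_gt0|exact: cvgy_powR].
Unshelve. all: by end_near. Qed.

Lemma power_growth_double s t : 0 <= s -> 2 `^ p^-1 * s <= t -> 2 * G s <= G t.
Proof.
move=> s0 st; have lambda1 : 1 <= 2 `^ p^-1 :> R.
  by rewrite ltW// powR_gt1 ?invr_gt0// ltr1n.
have /andP[+ _] := power_growth_ge1 s0 lambda1.
rewrite powRVK ?gt_eqF// => /le_trans; apply.
have ls0 : 0 <= 2 `^ p^-1 * s by rewrite mulr_ge0 ?powR_ge0.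
by rewrite (phi_function_le power_growth_phi_function) ?(le_trans ls0).
Qed.

Lemma power_growth_tilde : power_growth p q (tilde G).
Proof.
have phiG := power_growth_phi_function.
split => [|t t0|t a t0 a1]; rewrite ?tildeE//.
- by rewrite invr0 G0 invr0.
- by rewrite -tildeE// tilde_gt0.
have a0 := lt_le_trans ltr01 a1.
have ai : 0 < a^-1 <= 1 by rewrite invr_gt0 a0 invf_le1.
have ti0 : 0 < t^-1 by rewrite invr_gt0.
have /andP[Gq Gp] := power_growth_le1 (ltW ti0) ai.
have Gt := G_gt0 ti0; have Gat : 0 < G (a^-1 * t^-1).
  by rewrite G_gt0// mulr_gt0// invr_gt0.
have inv_powRM r : a `^ r * (G t^-1)^-1 = (a^-1 `^ r * G t^-1)^-1.
  by rewrite powR_invl ?(ltW a0)// invfM invrK.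
by rewrite invfM !inv_powRM !lef_pV2 ?Gp ?posrE ?mulr_gt0 ?powR_gt0 ?invr_gt0.
Qed.

End PowerGrowth.

Lemma exists_lacunary_seq {T : Type} {R : numDomainType}
    (P : T -> R -> Prop) (lambda : R) :
  (forall B, exists x y, B <= y /\ P x y) ->
  exists x y, forall k : nat, P (x k) (y k) /\ lambda * y k <= y k.+1.
Proof.
move=> /choice[X /choice[Y XY]].
pose B k := iter k (fun B => lambda * Y B) 1.
exists (X \o B), (Y \o B) => k; split; first by case: (XY (B k)).
by case: (XY (B k.+1)).
Qed.

Section DilationNorm.
Context {R : realType}.
Variable N : (R -> R) -> \bar R.
Implicit Types (a D K : R) (f : R -> R).

Lemma dil_norm_le a K :
  (forall f, measurable_fun (@halfline R) f ->
    (N (dilation a f) <= K%:E * N f)%E) ->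
  (dil_norm N a <= K%:E)%E.
Proof.
move=> NK; apply/ereal_supP => _ [f /= [mf [Nf0 Nfoo]] <-].
have Nf_fin : N f \is a fin_num by rewrite ge0_fin_numE// ltW.
have fineN0 : 0 < fine (N f) by rewrite -lte_fin fineK.
by rewrite muleC lee_pdivrMl// fineK// muleC NK.
Qed.

Lemma dil_norm_ge a D f : measurable_fun (@halfline R) f -> 0 <= D ->
  (0 < N f)%E -> (N f <= 1)%E -> (D%:E <= N (dilation a f))%E ->
  (D%:E <= dil_norm N a)%E.
Proof.
move=> mf D0 Nf0 Nf1 DN; have Nfoo := le_lt_trans Nf1 (ltry 1).
apply: (@le_trans _ _ (N (dilation a f) * ((fine (N f))^-1)%:E)%E); last first.
  by apply: ereal_sup_ubound; exists f.
have Nf_fin : N f \is a fin_num by rewrite ge0_fin_numE// ltW.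
have fineN0 : 0 < fine (N f) by rewrite -lte_fin fineK.
rewrite muleC lee_pdivlMl//; apply: le_trans DN.
by rewrite -EFinM lee_fin ler_piMl// -lee_fin fineK.
Qed.

End DilationNorm.

Section PowerGrowthDilation.
Context {R : realType}.
Variables (p q : R) (G : R -> R).
Hypotheses (p_gt0 : 0 < p) (GP : power_growth p q G).
Implicit Types (a D rho : R) (f : R -> R).

Let q_gt0 : 0 < q. Proof. exact: power_growth_exponent_gt0 GP. Qed.
Let phiG : phi_function G. Proof. exact: power_growth_phi_function GP. Qed.
Let TP : power_growth p q (tilde G). Proof. exact: power_growth_tilde GP. Qed.

Lemma L1G_norm_dilation_le1 a f :
  measurable_fun (@halfline R) f -> 0 < a <= 1 ->
  (L1G_norm G (dilation a f) <= (a `^ (- (q / p)))%:E * L1G_norm G f)%E.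
Proof.
move=> mf a01; have [a0 a1] := andP a01.
apply: (@L1G_norm_dilation_le _ _ phiG a (a `^ q)) => //;
  rewrite ?powR_gt0// => x x0.
- by case/andP: (power_growth_le1 TP x0 a01).
- have apq : 0 < a `^ (q / p) <= 1.
    by rewrite powR_gt0//= -(powRr0 a) (ger_powR a01)// divr_ge0 ?ltW.
  have /andP[_] := power_growth_le1 GP x0 apq.
  by rewrite -powRrM divfK ?gt_eqF// powRN invrK mulrC.
Qed.

Lemma L1G_norm_dilation_ge1 a f :
  measurable_fun (@halfline R) f -> 1 <= a ->
  (L1G_norm G (dilation a f) <= (a `^ (- (p / q)))%:E * L1G_norm G f)%E.
Proof.
move=> mf a1; have a0 := lt_le_trans ltr01 a1.
apply: (@L1G_norm_dilation_le _ _ phiG a (a `^ p)) => //;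
  rewrite ?powR_gt0// => x x0.
- by case/andP: (power_growth_ge1 TP x0 a1).
- have apq : 1 <= a `^ (p / q) by rewrite -(powRr0 a) ler_powR// divr_ge0 ?ltW.
  have /andP[_] := power_growth_ge1 GP x0 apq.
  by rewrite -powRrM divfK ?gt_eqF// powRN invrK mulrC.
Qed.

Lemma L1G_norm_gt0_dilation a f : measurable_fun (@halfline R) f -> 0 < a ->
  (0 < L1G_norm G (dilation a f))%E -> (0 < L1G_norm G f)%E.
Proof.
move=> mf a0 /lt_le_trans dil_gt0; have [a1|/ltW a1] := leP a 1.
- have a01 : 0 < a <= 1 by rewrite a0.
  have /dil_gt0 := L1G_norm_dilation_le1 mf a01.
  by rewrite pmule_rgt0// lte_fin powR_gt0.
- have /dil_gt0 := L1G_norm_dilation_ge1 mf a1.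
  by rewrite pmule_rgt0// lte_fin powR_gt0.
Qed.

Lemma dil_norm_L1G_ge_lacunary a D rho (x y : nat -> R) :
  0 < a -> 0 < D -> 2 <= rho ->
  (forall k, 0 < x k) -> (forall k, 0 < y k) ->
  (forall k, 2 `^ p^-1 * y k <= y k.+1) ->
  (forall k, rho * G (y k) <= G (x k)) ->
  (forall k, 8 * G (a * x k) <= rho * G (y k / D)) ->
  (D%:E <= dil_norm (L1G_norm G) a)%E.
Proof.
move=> a0 D0 rho2 x0 y0 yS Gyx Gax; have [_ G_gt0 _] := GP.
set N := Num.truncn rho; pose w k := (x k)^-1; pose f := step_max N w y.
have rho0 : 0 < rho by lra.
have /andP[N_le /ltW N_ge] : N%:R <= rho < N.+1%:R by apply: truncn_itv; lra.
have w0 k : 0 < w k by rewrite invr_gt0.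
have wa0 k : 0 < w k / a by rewrite divr_gt0.
have mf : measurable_fun (@halfline R) f.
  by apply: measurable_step_max; exact: measurable_itv.
have tildeG_w b k : 0 < b -> tilde G (w k / b) = (G (b * x k))^-1.
  by move=> b0; rewrite tildeE// invfM !invrK mulrC.
have Nf1 : (L1G_norm G f <= 1)%E.
  apply: L1G_norm_step_max_le => //.
  apply: (@le_trans _ _ (\sum_(k < N) rho^-1)).
    apply: ler_sum => k _; rewrite divr1 -[w k]divr1 tildeG_w// mul1r.
    by rewrite ler_pdivrMr ?G_gt0// ler_pdivlMl.
  by rewrite sumr_const card_ord -[leLHS]mulr_natr ler_pdivrMl ?mulr1.
have DNf : (D%:E <= L1G_norm G (dilation a f))%E.
  rewrite dilation_step_max//; apply: L1G_norm_step_max_ge => // [k|].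
    apply: (power_growth_double p_gt0 GP); first by rewrite divr_ge0 ?ltW.
    by rewrite mulrA ler_pM2r ?invr_gt0.
  apply: (@lt_le_trans _ _ (\sum_(k < N) 8 / rho)).
    rewrite sumr_const card_ord -[X in _ < X]mulr_natr mulrAC ltr_pdivlMr//.
    by move: N_ge; rewrite -natr1; lra.
  apply: ler_sum => k _; rewrite tildeG_w//.
  by rewrite ler_pdivrMr// mulrAC ler_pdivlMr ?G_gt0 ?mulr_gt0// [_ * rho]mulrC.
apply: (dil_norm_ge mf (ltW D0) _ Nf1 DNf).
by apply: L1G_norm_gt0_dilation a0 _ => //; exact: lt_le_trans DNf.
Qed.

Lemma dil_norm_L1G_ge a D rho : 0 < a -> 0 < D -> 2 <= rho ->
  (forall B, exists x y, B <= y /\ [/\ 0 < x, 0 < y,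
     rho * G y <= G x & 8 * G (a * x) <= rho * G (y / D)]) ->
  (D%:E <= dil_norm (L1G_norm G) a)%E.
Proof.
move=> a0 D0 rho2 /(exists_lacunary_seq (2 `^ p^-1))[x [y xy]].
by apply: (@dil_norm_L1G_ge_lacunary a D rho x y) => // k;
  have [[]] := xy k.
Qed.

End PowerGrowthDilation.

Definition power_break {R : realType} (r s : R) (G : R -> R) : Prop :=
  forall A B : R, exists u : R, [/\ 0 < u, B <= u &
    forall a, 1 <= a -> a <= A ->
      a `^ r * G (u / a) = G u /\ G (a * u) = a `^ s * G u].

Lemma power_break_expR {R : realType} (r s : R) (G : R -> R) :
  (forall M, exists2 v, M <= v & forall a, 1 <= a -> ln a <= M ->
     a `^ r * G (expR v / a) = G (expR v) /\
     G (a * expR v) = a `^ s * G (expR v)) ->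
  power_break r s G.
Proof.
move=> Gv A B; have [v] := Gv (Num.max (ln A) B).
rewrite ge_max => /andP[Av Bv] vG; exists (expR v); split.
- exact: expR_gt0.
- by apply: le_trans (expR_ge1Dx _); lra.
- move=> a a1 aA; apply: vG => //; rewrite le_max ler_ln ?aA// posrE.
    exact: lt_le_trans a1.
  by rewrite (lt_le_trans ltr01)// (le_trans a1).
Qed.

Section PowerBreakIndices.
Context {R : realType}.
Variables (p q : R) (G : R -> R).
Hypotheses (p_gt0 : 0 < p) (GP : power_growth p q G).
Hypotheses (pqG : power_break p q G) (qpG : power_break q p G).
Implicit Types a b : R.

Let q_gt0 : 0 < q. Proof. exact: power_growth_exponent_gt0 GP. Qed.
Let G_gt0 t : 0 < t -> 0 < G t. Proof. by case: GP => _ + _; apply. Qed.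

Lemma MO_lower_power_break : MO_lower G = p%:E.
Proof.
apply/eqP; rewrite eq_le; apply/andP; split; last first.
  apply: ereal_sup_ubound; exists p => //=; exists 1 => // t a t0 /ltW a1.
  by rewrite mul1r; case/andP: (power_growth_ge1 GP t0 a1).
apply/ereal_supP => _ [r [c c0 cG] <-]; rewrite lee_fin.
apply: (@near_powR_le_exponent _ c 1) => //; near=> a.
have a1 : 1 < a by near: a; apply: nbhs_pinfty_gt; exact: num_real.
have [u [u0 _ /(_ a (ltW a1) (lexx a))[_ Gau]]] := qpG a 1.
by rewrite mul1r -(ler_pM2r (G_gt0 u0)) -Gau cG// ltW.
Unshelve. all: by end_near. Qed.

Lemma MO_upper_power_break : MO_upper G = q%:E.
Proof.
apply/eqP; rewrite eq_le; apply/andP; split.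
  apply: ereal_inf_lbound; exists q => //=; exists 1 => t a t0 /ltW a1.
  by rewrite mul1r; case/andP: (power_growth_ge1 GP t0 a1).
apply: le_ereal_inf_tmp => _ [r [c cG] <-]; rewrite lee_fin.
apply: (@near_powR_le_exponent _ 1 c) => //; near=> a.
have a1 : 1 < a by near: a; apply: nbhs_pinfty_gt; exact: num_real.
have [u [u0 _ /(_ a (ltW a1) (lexx a))[_ Gau]]] := pqG a 1.
by rewrite mul1r -(ler_pM2r (G_gt0 u0)) -Gau cG// ltW.
Unshelve. all: by end_near. Qed.

Lemma dil_norm_inv_lower_bound b : 1 <= b -> 8 <= b `^ q ->
  (((b `^ q / 8) `^ p^-1)%:E <= dil_norm (L1G_norm G) b^-1)%E.
Proof.
move=> b1 bq8; have b0 := lt_le_trans ltr01 b1.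
set D := _ `^ p^-1.
have z1 : 1 <= b `^ q / 8 by lra.
have Dp : D `^ p = b `^ q / 8 by rewrite powRVK ?gt_eqF//; lra.
have D1 : 1 <= D.
  have pi0 : 0 <= p^-1 by rewrite invr_ge0 ltW.
  by rewrite -(powRr0 (b `^ q / 8)) /D ler_powR.
apply: (@dil_norm_L1G_ge _ p q _ p_gt0 GP _ _ (b `^ q)) => [|||B];
  [by rewrite invr_gt0|lra|lra|].
have [u [u0 Bu uG]] := pqG (Num.max b D) B.
have [|_ Gbu] := uG b b1; first by rewrite le_max lexx.
have [|GuD _] := uG D D1; first by rewrite le_max lexx orbT.
exists (b * u), u; rewrite mulKf ?gt_eqF// mulr_gt0// Gbu lexx.
by do 2!split => //; rewrite -GuD Dp mulrA mulrCA divff// mulr1.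
Qed.

Lemma dil_norm_lower_bound a : 1 <= a ->
  (((8 * a `^ p) `^ (- q^-1))%:E <= dil_norm (L1G_norm G) a)%E.
Proof.
move=> a1; have a0 := lt_le_trans ltr01 a1; rewrite powRN.
set D := _ `^ q^-1.
have ap1 : 1 <= a `^ p by rewrite -(powRr0 a) ler_powR// ltW.
have Dq : D `^ q = 8 * a `^ p by rewrite powRVK ?gt_eqF//; lra.
have D1 : 1 <= D.
  have qi0 : 0 <= q^-1 by rewrite invr_ge0 ltW.
  by rewrite -(powRr0 (8 * a `^ p)) /D ler_powR//; lra.
have D0 : 0 < D by lra.
apply: (@dil_norm_L1G_ge _ p q _ p_gt0 GP _ _ (8 * a `^ p)) => // [||B];
  [by rewrite invr_gt0|lra|].
have [u [u0 Bu uG]] := qpG (Num.max a D) (B * D).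
have [|_ Gau] := uG a a1; first by rewrite le_max lexx.
have [|GuD _] := uG D D1; first by rewrite le_max lexx orbT.
exists u, (u / D); rewrite ler_pdivlMr// divr_gt0// invrK divfK ?gt_eqF//.
by rewrite Gau -GuD Dq mulrA lexx.
Qed.

Lemma boyd_lower_power_break : boyd_lower (L1G_norm G) = (p / q)%:E.
Proof.
apply/eqP; rewrite eq_le; apply/andP; split; last first.
  apply: ereal_sup_ubound; exists (p / q) => //=; rewrite divr_gt0//.
  split => //; exists 1 => a a0 /ltW a1.
  rewrite mul1r invf_div; apply: dil_norm_le => f mf.
  by apply: (L1G_norm_dilation_le1 p_gt0 GP) => //; rewrite a0.
apply/ereal_supP => _ [r [r0 [c dil_c]] <-]; rewrite lee_fin -[leRHS]invf_div.
rewrite -[r]invrK lef_pV2 ?posrE ?divr_gt0 ?invr_gt0//.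
apply: (@near_powR_le_exponent _ (8^-1 `^ p^-1) c); first by rewrite powR_gt0.
near=> b.
have b1 : 1 < b by near: b; apply: nbhs_pinfty_gt; exact: num_real.
have bq8 : 8 <= b `^ q by near: b; apply: (cvgry_ge (cvgy_powR q_gt0)).
have b0 := lt_trans ltr01 b1.
have -> : 8^-1 `^ p^-1 * b `^ (q / p) = (b `^ q / 8) `^ p^-1.
  by rewrite powRM ?powR_ge0// -powRrM mulrC.
have -> : b `^ r^-1 = b^-1 `^ (- r^-1).
  by rewrite powR_invl ?(ltW b0)// powRN invrK.
rewrite -lee_fin (le_trans (dil_norm_inv_lower_bound (ltW b1) bq8))//.
by rewrite dil_c ?invr_gt0// invf_lt1.
Unshelve. all: by end_near. Qed.

Lemma boyd_upper_power_break : boyd_upper (L1G_norm G) = (q / p)%:E.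
Proof.
apply/eqP; rewrite eq_le; apply/andP; split.
  apply: ereal_inf_lbound; exists (q / p) => //=; rewrite divr_gt0//.
  split => //; exists 1 => a /ltW a1.
  rewrite mul1r invf_div; apply: dil_norm_le => f mf.
  exact: (L1G_norm_dilation_ge1 p_gt0 GP).
apply: le_ereal_inf_tmp => _ [r [r0 [c dil_c]] <-]; rewrite lee_fin.
rewrite -[leLHS]invf_div -[r]invrK lef_pV2 ?posrE ?divr_gt0 ?invr_gt0// -lerN2.
apply: (@near_powR_le_exponent _ (8 `^ (- q^-1)) c); first by rewrite powR_gt0.
near=> a.
have a1 : 1 < a by near: a; apply: nbhs_pinfty_gt; exact: num_real.
have -> : 8 `^ (- q^-1) * a `^ (- (p / q)) = (8 * a `^ p) `^ (- q^-1).
  by rewrite powRM ?powR_ge0// -powRrM mulrN.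
by rewrite -lee_fin (le_trans (dil_norm_lower_bound (ltW a1)))// dil_c.
Unshelve. all: by end_near. Qed.

End PowerBreakIndices.

Lemma exists_natX_ge {R : realType} (n : nat) (v : R) : (1 < n)%N ->
  exists k, v <= n%:R ^+ k.
Proof.
move=> n1; exists (Num.truncn `|v|).+1; apply: (le_trans (ler_norm v)).
have /andP[_ /ltW/le_trans] := truncn_itv (normr_ge0 v); apply.
by rewrite -natrX ler_nat ltnW// ltn_expl.
Qed.

Section Sawtooth.
Context {R : realType}.
Implicit Types (k : nat) (v w t a : R).

Definition sawtooth v : R := inf (range (fun k => `|v - 3 ^+ k|)).

Lemma sawtooth_le k v : sawtooth v <= `|v - 3 ^+ k|.
Proof. by apply: ge_inf; [exists 0 => _ [j _ <-]|exists k]. Qed.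

Lemma le_sawtooth v w : (forall k, w <= `|v - 3 ^+ k|) -> w <= sawtooth v.
Proof.
move=> wv; apply: lb_le_inf => [|_ [k _ <-]] //.
by exists `|v - 3 ^+ 0|; exists 0%N.
Qed.

Lemma sawtooth_lipschitz v w : `|sawtooth v - sawtooth w| <= `|v - w|.
Proof.
have saw_le x y : sawtooth x - `|x - y| <= sawtooth y.
  apply: le_sawtooth => k; rewrite lerBlDr addrC.
  by rewrite (le_trans (sawtooth_le k x))// -{1}(subrK y x) -addrA ler_normD.
by have := saw_le v w; have := saw_le w v; rewrite distrC ler_norml; lra.
Qed.

Lemma sawtooth_between k v : 3 ^+ k <= v <= 3 ^+ k.+1 ->
  sawtooth v = Num.min (v - 3 ^+ k) (3 ^+ k.+1 - v).
Proof.
move=> /andP[kv vk]; apply/eqP; rewrite eq_le; apply/andP; split.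
- rewrite le_min; apply/andP; split.
  + by rewrite -[leRHS]ger0_norm ?subr_ge0// sawtooth_le.
  + by rewrite -[leRHS]ger0_norm ?subr_ge0// distrC sawtooth_le.
- apply: le_sawtooth => j; case: (leqP j k) => [jk|kj].
  + have jk3 : 3 ^+ j <= 3 ^+ k :> R by rewrite ler_eXn2l// ltr1n.
    rewrite ge_min (@ger0_norm _ (v - 3 ^+ j)) ?lerD2l ?lerN2 ?jk3//.
    by rewrite subr_ge0 (le_trans jk3).
  + have kj3 : 3 ^+ k.+1 <= 3 ^+ j :> R by rewrite ler_eXn2l// ltr1n.
    rewrite ge_min distrC (@ger0_norm _ (3 ^+ j - v)) ?lerD2r ?kj3 ?orbT//.
    by rewrite subr_ge0 (le_trans vk).
Qed.

Lemma sawtooth_rise k v : 3 ^+ k <= v <= 2 * 3 ^+ k -> sawtooth v = v - 3 ^+ k.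
Proof.
move=> /andP[kv vk]; have k3 : 0 < 3 ^+ k :> R by rewrite exprn_gt0.
by rewrite (@sawtooth_between k) ?min_l// exprS; [lra|rewrite kv/=; lra].
Qed.

Lemma sawtooth_fall k v : 2 * 3 ^+ k <= v <= 3 ^+ k.+1 ->
  sawtooth v = 3 ^+ k.+1 - v.
Proof.
move=> /andP[kv vk]; have k3 : 0 < 3 ^+ k :> R by rewrite exprn_gt0.
rewrite (@sawtooth_between k) ?min_r ?vk ?andbT//; last lra.
by move: vk; rewrite exprS; lra.
Qed.

Variables p q : R.

(* In the coordinate [v = ln t], [ln G] has slope [q] on [[3^k, 2 * 3^k]] and
   slope [p] on [[2 * 3^k, 3^(k+1)]]. *)
Definition sawtooth_phi t : R :=
  t `^ ((p + q) / 2) * expR ((q - p) / 2 * sawtooth (ln t)).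
Local Notation G := sawtooth_phi.

Lemma sawtooth_phi_gt0 t : 0 < t -> 0 < G t.
Proof. by move=> t0; rewrite mulr_gt0 ?powR_gt0 ?expR_gt0. Qed.

Lemma sawtooth_phiM t a : 0 < t -> 0 < a ->
  G (a * t) = G t * expR ((p + q) / 2 * ln a +
    (q - p) / 2 * (sawtooth (ln t + ln a) - sawtooth (ln t))).
Proof.
move=> t0 a0; rewrite /sawtooth_phi /powR !gt_eqF ?mulr_gt0// -!expRD.
by rewrite lnM ?posrE// [ln a + _]addrC; congr expR; ring.
Qed.

Lemma sawtooth_phi_rise t a : 0 < t -> 0 < a ->
  sawtooth (ln t + ln a) - sawtooth (ln t) = ln a -> G (a * t) = a `^ q * G t.
Proof.
move=> t0 a0 rise; rewrite sawtooth_phiM// rise /powR gt_eqF//.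
by rewrite [RHS]mulrC; congr (_ * expR _); field.
Qed.

Lemma sawtooth_phi_fall t a : 0 < t -> 0 < a ->
  sawtooth (ln t + ln a) - sawtooth (ln t) = - ln a -> G (a * t) = a `^ p * G t.
Proof.
move=> t0 a0 fall; rewrite sawtooth_phiM// fall /powR gt_eqF//.
by rewrite [RHS]mulrC; congr (_ * expR _); field.
Qed.

Lemma power_growth_sawtooth_phi : 0 < p -> p <= q -> power_growth p q G.
Proof.
move=> p0 pq; split => [|t|t a t0 a1].
- rewrite /sawtooth_phi powR0 ?mul0r// gt_eqF//; lra.
- exact: sawtooth_phi_gt0.
have a0 := lt_le_trans ltr01 a1; have lna := ln_ge0 a1.
have := sawtooth_lipschitz (ln t + ln a) (ln t).
rewrite addrAC subrr add0r (ger0_norm lna) ler_norml => /andP[saw_ge saw_le].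
rewrite sawtooth_phiM// ![_ * G t]mulrC !ler_pM2l ?sawtooth_phi_gt0//.
rewrite /powR gt_eqF// !ler_expR.
by apply/andP; split; nra.
Qed.

Lemma power_break_sawtooth_phi_trough : power_break p q G.
Proof.
apply: power_break_expR => M.
have [k Mk] := exists_natX_ge M (isT : 1 < 3)%N.
exists (3 ^+ k.+1); first by rewrite (le_trans Mk)// ler_eXn2l// ltr1n.
move=> a a1 /le_trans/(_ Mk) ak.
have a0 := lt_le_trans ltr01 a1; have lna := ln_ge0 a1.
have u0 := expR_gt0 (3 ^+ k.+1 : R).
have kS : 3 ^+ k.+1 = 3 * 3 ^+ k :> R := exprS 3 k.
have kSS : 3 ^+ k.+2 = 3 * 3 ^+ k.+1 :> R := exprS 3 k.+1.
split.
- rewrite -sawtooth_phi_fall ?divr_gt0// ?[a * _]mulrC ?divfK ?gt_eqF//.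
  by rewrite ln_div ?posrE// expRK subrK !(@sawtooth_fall k); lra.
- by apply: sawtooth_phi_rise => //; rewrite expRK !(@sawtooth_rise k.+1); lra.
Qed.

Lemma power_break_sawtooth_phi_peak : power_break q p G.
Proof.
apply: power_break_expR => M.
have [k Mk] := exists_natX_ge M (isT : 1 < 3)%N.
have k3 : 0 < 3 ^+ k :> R by rewrite exprn_gt0.
exists (2 * 3 ^+ k); first lra.
move=> a a1 /le_trans/(_ Mk) ak.
have a0 := lt_le_trans ltr01 a1; have lna := ln_ge0 a1.
have u0 := expR_gt0 (2 * 3 ^+ k : R).
have kS : 3 ^+ k.+1 = 3 * 3 ^+ k :> R := exprS 3 k.
split.
- rewrite -sawtooth_phi_rise ?divr_gt0// ?[a * _]mulrC ?divfK ?gt_eqF//.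
  by rewrite ln_div ?posrE// expRK subrK !(@sawtooth_rise k); lra.
- by apply: sawtooth_phi_fall => //; rewrite expRK !(@sawtooth_fall k); lra.
Qed.

End Sawtooth.

Theorem theorem4p1 (R : realType) (p q : R) :
  0 < p -> p < q ->
  exists G : R -> R,
    [/\ phi_function G,
        MO_lower G = (p%:E)%E,
        MO_upper G = (q%:E)%E,
        boyd_lower (L1G_norm G) = ((p / q)%:E)%E &
        boyd_upper (L1G_norm G) = ((q / p)%:E)%E].
Proof.
move=> p0 /ltW pq; exists (sawtooth_phi p q).
have GP := power_growth_sawtooth_phi p0 pq.
have pqG := power_break_sawtooth_phi_trough p q.
have qpG := power_break_sawtooth_phi_peak p q.
split.
- exact: power_growth_phi_function GP.
- exact: MO_lower_power_break GP qpG.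
- exact: MO_upper_power_break GP pqG.
- exact: boyd_lower_power_break GP pqG.
- exact: boyd_upper_power_break GP qpG.
Qed.
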